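(* There exists an infinite sequence $(P_n)_{n\ge 0}$ of points of $\mathbb{Z}^3$ such that all of the following hold simultaneously: (1) no three terms are collinear, i.e. for all integers $0\le a<b<c$ the points $P_a,P_b,P_c$ do not lie on a common line in $\mathbb{R}^3$; (2) for every integer $n\ge 0$, $$P_{n+1}-P_n\in\{-2,-1,0,1,2\}^2\times\{1,2,3,4,5,6,7\};$$ (3) only sixteen successive displacement vectors occur, i.e. the set $\{P_{n+1}-P_n : n\ge 0\}$ has at most $16$ elements.
   Context: Points of $\mathbb{Z}^3$ are regarded as points of $\mathbb{R}^3$. Three terms $P_a,P_b,P_c$ (with distinct indices $a,b,c$) are collinear if some affine line in $\mathbb{R}^3$ contains all three; in particular, if two of the three points coincide, they are collinear. *)

(* Defs.v *)
From Stdlib Require Export ZArith Reals Ensembles Finite_sets Image List.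
Import ListNotations.

Definition Z3 : Type := (Z * Z * Z)%type.
Definition R3 : Type := (R * R * R)%type.

Definition Z3_sub (p q : Z3) : Z3 :=
  let '(p1, p2, p3) := p in
  let '(q1, q2, q3) := q in
  (p1 - q1, p2 - q2, p3 - q3)%Z.

Definition Z3_to_R3 (p : Z3) : R3 :=
  let '(p1, p2, p3) := p in (IZR p1, IZR p2, IZR p3).

Definition on_line (o v x : R3) : Prop :=
  let '(o1, o2, o3) := o in
  let '(v1, v2, v3) := v in
  exists t : R, x = (o1 + t * v1, o2 + t * v2, o3 + t * v3)%R.

(* The points need not be distinct: if two of them coincide, the three are
   collinear.  The condition on v excludes lines degenerate to a point. *)
Definition collinear (p q r : R3) : Prop :=
  exists o v : R3,
    v <> (0, 0, 0)%R /\ on_line o v p /\ on_line o v q /\ on_line o v r.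

Definition displacement (P : nat -> Z3) (n : nat) : Z3 :=
  Z3_sub (P (S n)) (P n).

Definition displacements (P : nat -> Z3) : Ensemble Z3 :=
  Im nat Z3 (Full_set nat) (displacement P).

Definition step_box (d : Z3) : Prop :=
  let '(d1, d2, d3) := d in
  In d1 [ -2; -1; 0; 1; 2 ]%Z /\
  In d2 [ -2; -1; 0; 1; 2 ]%Z /\
  In d3 [ 1; 2; 3; 4; 5; 6; 7 ]%Z.

Definition at_most {U : Type} (k : nat) (A : Ensemble U) : Prop :=
  exists m : nat, cardinal U A m /\ (m <= k)%nat.

(* Main.v *)
(** The projection to the first two coordinates follows the Lévy C curve
    [levy n = \sum_(j < n) i^(s(j))], where [s] is the binary digit sum, and
    the heading [s(n) mod 4] also selects one of four residues for [P n]: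
    [P n = (2 * levy n + corner, 4 * n + heading)].
    Consecutive headings determine the displacement, which leaves sixteen.

    For any two terms the difference [(x, y, z)] is balanced: [x^2 + y^2] and
    [z] are divisible by the same power of 2.  For different headings this is
    visible modulo 8; for equal headings it follows from
    [levy (2 * n) = (1 + i) * levy n] by descent on binary digits.
    If [(x, y, z)] and [(x', y', z')] are parallel then
    [(x^2 + y^2) * z'^2 = (x'^2 + y'^2) * z^2], so balanced parallel vectors have
    equal exponents [k].  For three collinear terms this makes the differences
    of the third coordinates, divided by [2^k], three odd numbers one of which
    is the sum of the others. *)
From Stdlib Require Import NArith Lia Classical.
From Stdlib Require Import FunctionalExtensionality PropExtensionality.
Require Import Defs.
Import ListNotations.

Lemma at_most_of_list {U : Type} (l : list U) (A : Ensemble U) :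
  (forall x, A x -> In x l) -> at_most (length l) A.
Proof.
  revert A. induction l as [|a l IH]; intros A HA.
  - exists 0%nat. split; [|simpl; lia].
    replace A with (Empty_set U); [constructor|].
    apply functional_extensionality. intro x. apply propositional_extensionality.
    split; intro H; [destruct H|destruct (HA x H)].
  - destruct (classic (A a)) as [Ha|Ha].
    + destruct (IH (Setminus U A (Singleton U a))) as [m [Hm Hle]].
      { intros x [Hx Hxa]. destruct (HA x Hx) as [<-|H]; [|exact H].
        destruct Hxa. constructor. }
      exists (S m). split; [|simpl; lia].
      replace A with (Ensembles.Add U (Setminus U A (Singleton U a)) a).
      { constructor; [exact Hm|]. intros [_ H]. apply H. constructor. }
      apply functional_extensionality. intro x. apply propositional_extensionality.
      split.
      * intros [y [Hy _]|y []]; [exact Hy|exact Ha].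
      * intro Hx. destruct (classic (x = a)) as [->|Hne].
        -- right. constructor.
        -- left. split; [exact Hx|]. intro Hxa. apply Hne. now destruct Hxa.
    + destruct (IH A) as [m [Hm Hle]].
      { intros x Hx. destruct (HA x Hx) as [<-|H]; [contradiction|exact H]. }
      exists m. split; [exact Hm|simpl; lia].
Qed.

(** If the points have parameters [s], [t], [u] on the line, both sides of the first equation equal
    [(t - s) * (u - s) * v1 * v3]; the second has [v2] for [v1]. *)
Lemma collinear_parallel (x1 y1 z1 x2 y2 z2 x3 y3 z3 : Z) :
  collinear (Z3_to_R3 (x1, y1, z1)) (Z3_to_R3 (x2, y2, z2)) (Z3_to_R3 (x3, y3, z3)) ->
  ((x2 - x1) * (z3 - z1) = (x3 - x1) * (z2 - z1) /\
   (y2 - y1) * (z3 - z1) = (y3 - y1) * (z2 - z1))%Z.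
Proof.
  intros [[[o1 o2] o3] [[[v1 v2] v3] [_ [[s Hs] [[t Ht] [u Hu]]]]]].
  simpl in Hs, Ht, Hu. injection Hs as Hx1 Hy1 Hz1.
  injection Ht as Hx2 Hy2 Hz2. injection Hu as Hx3 Hy3 Hz3.
  split; apply eq_IZR; rewrite !mult_IZR, !minus_IZR.
  - rewrite Hx1, Hx2, Hx3, Hz1, Hz2, Hz3. ring.
  - rewrite Hy1, Hy2, Hy3, Hz1, Hz2, Hz3. ring.
Qed.

Open Scope Z_scope.

(** * Balanced vectors and collinearity *)

Lemma pow2_odd_inj (i j : nat) (u v : Z) :
  2 ^ Z.of_nat i * (2 * u + 1) = 2 ^ Z.of_nat j * (2 * v + 1) -> i = j.
Proof.
  revert j. induction i as [|i IH]; intros [|j];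
    rewrite ?Nat2Z.inj_succ, ?Z.pow_succ_r by lia; intro H.
  - reflexivity.
  - change (2 ^ Z.of_nat 0) with 1 in H. lia.
  - change (2 ^ Z.of_nat 0) with 1 in H. lia.
  - f_equal. apply IH. lia.
Qed.

Definition balanced (k : nat) (x y z : Z) : Prop :=
  exists u v,
    x * x + y * y = 2 ^ Z.of_nat k * (2 * u + 1) /\ z = 2 ^ Z.of_nat k * (2 * v + 1).

Lemma balanced_eq (k : nat) (x y z x' y' z' : Z) :
  balanced k x y z -> x = x' -> y = y' -> z = z' -> balanced k x' y' z'.
Proof. now intros H <- <- <-. Qed.

Lemma balanced_parallel (k k' : nat) (x y z x' y' z' : Z) :
  balanced k x y z -> balanced k' x' y' z' ->
  x * z' = x' * z -> y * z' = y' * z -> k = k'.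
Proof.
  intros (u & v & Hn & Hz) (u' & v' & Hn' & Hz') Hx Hy.
  assert (H : (x * x + y * y) * (z' * z') = (x' * x' + y' * y') * (z * z)).
  { replace ((x * x + y * y) * (z' * z')) with ((x * z') * (x * z') + (y * z') * (y * z')) by ring.
    rewrite Hx, Hy. ring. }
  rewrite Hn, Hn', Hz, Hz' in H.
  (* [2 * w + 1 = (2 * u + 1) * (2 * v' + 1)^2], and symmetrically for [w']: these are the odd parts
     of the two sides of [H]. *)
  set (w := u * (2 * v' + 1) * (2 * v' + 1) + 2 * v' * (v' + 1)).
  set (w' := u' * (2 * v + 1) * (2 * v + 1) + 2 * v * (v + 1)).
  enough (k + (k' + k') = k' + (k + k))%nat by lia.
  apply (pow2_odd_inj _ _ w w').
  rewrite !Nat2Z.inj_add, !Z.pow_add_r by lia. unfold w, w'.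
  transitivity (2 ^ Z.of_nat k * (2 * u + 1) *
    (2 ^ Z.of_nat k' * (2 * v' + 1) * (2 ^ Z.of_nat k' * (2 * v' + 1)))); [ring|].
  rewrite H. ring.
Qed.

Lemma balanced_not_collinear (x1 y1 z1 x2 y2 z2 x3 y3 z3 : Z) (i j k : nat) :
  balanced i (x2 - x1) (y2 - y1) (z2 - z1) ->
  balanced j (x3 - x2) (y3 - y2) (z3 - z2) ->
  balanced k (x3 - x1) (y3 - y1) (z3 - z1) ->
  ~ collinear (Z3_to_R3 (x1, y1, z1)) (Z3_to_R3 (x2, y2, z2)) (Z3_to_R3 (x3, y3, z3)).
Proof.
  intros Hi Hj Hk [Hx Hy]%collinear_parallel.
  assert (i = k) by (eapply balanced_parallel; eassumption).
  (* Subtracting [Hx] and [Hy] from trivial identities shows that the second difference is parallel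
     to the third as well. *)
  assert (j = k) by (eapply balanced_parallel; [exact Hj|exact Hk|lia|lia]).
  subst i j. destruct Hi as (_ & u & _ & Hu), Hj as (_ & v & _ & Hv), Hk as (_ & w & _ & Hw).
  assert (0 < 2 ^ Z.of_nat k) by (apply Z.pow_pos_nonneg; lia).
  assert (2 * u + 1 + (2 * v + 1) = 2 * w + 1) by (apply (Z.mul_reg_l _ _ (2 ^ Z.of_nat k)); lia).
  lia.
Qed.

(** * Headings and the Lévy curve *)

Inductive heading := East | North | West | South.

Definition turn (h : heading) : heading :=
  match h with East => North | North => West | West => South | South => East end.

Lemma turn_inj (g h : heading) : turn g = turn h -> g = h.
Proof. destruct g, h; discriminate || reflexivity. Qed.

Definition unit_x (h : heading) : Z :=
  match h with East => 1 | West => -1 | _ => 0 end.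

Definition unit_y (h : heading) : Z :=
  match h with North => 1 | South => -1 | _ => 0 end.

(** One turn from [East] for each binary digit 1: the digit sum modulo 4. *)
Fixpoint heading_pos (p : positive) : heading :=
  match p with
  | xH => North
  | xO q => heading_pos q
  | xI q => turn (heading_pos q)
  end.

Definition heading_at (n : nat) : heading :=
  match N.of_nat n with N0 => East | Npos p => heading_pos p end.

Lemma heading_at_double (n : nat) : heading_at (2 * n) = heading_at n.
Proof. unfold heading_at. rewrite Nat2N.inj_double. now destruct (N.of_nat n). Qed.

Lemma heading_at_succ_double (n : nat) : heading_at (S (2 * n)) = turn (heading_at n).
Proof. unfold heading_at. rewrite Nat2N.inj_succ_double. now destruct (N.of_nat n). Qed.

Fixpoint levy_x (n : nat) : Z :=
  match n with O => 0 | S m => levy_x m + unit_x (heading_at m) end.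

Fixpoint levy_y (n : nat) : Z :=
  match n with O => 0 | S m => levy_y m + unit_y (heading_at m) end.

(* Two consecutive steps from an even index add up to [i^s + i^(s+1) = (1 + i) * i^s]. *)
Lemma levy_double (n : nat) :
  levy_x (2 * n) = levy_x n - levy_y n /\ levy_y (2 * n) = levy_x n + levy_y n.
Proof.
  induction n as [|n [IHx IHy]]; [easy|].
  replace (2 * S n)%nat with (S (S (2 * n))) by lia.
  cbn [levy_x levy_y]. rewrite IHx, IHy, heading_at_succ_double, heading_at_double.
  destruct (heading_at n); simpl; lia.
Qed.

Lemma levy_succ_double (n : nat) :
  levy_x (S (2 * n)) = levy_x n - levy_y n + unit_x (heading_at n) /\
  levy_y (S (2 * n)) = levy_x n + levy_y n + unit_y (heading_at n).
Proof.
  cbn [levy_x levy_y]. destruct (levy_double n) as [-> ->].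
  now rewrite heading_at_double.
Qed.

(** Modulo 2, [x^2 + y^2] agrees with [x + y]. *)
Lemma balanced_odd (x y z : Z) :
  Z.odd (x + y) = true -> Z.odd z = true -> balanced 0 x y z.
Proof.
  intros [a Ha]%Z.odd_spec [b Hb]%Z.odd_spec.
  exists (2 * a * a + 2 * a - x * y), b. change (2 ^ Z.of_nat 0) with 1.
  split; [|lia].
  replace (x * x + y * y) with ((x + y) * (x + y) - 2 * (x * y)) by ring.
  rewrite Ha. ring.
Qed.

(** Multiplying [x + i*y] by [1 + i] doubles its norm. *)
Lemma balanced_scale (k : nat) (x y z : Z) :
  balanced k x y z -> balanced (S k) (x - y) (x + y) (2 * z).
Proof.
  intros (u & v & Hn & Hz). exists u, v.
  rewrite Nat2Z.inj_succ, Z.pow_succ_r by lia. split; [|lia].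
  replace ((x - y) * (x - y) + (x + y) * (x + y)) with (2 * (x * x + y * y)) by ring.
  rewrite Hn. ring.
Qed.

Lemma even_or_odd (n : nat) : exists m, n = (2 * m)%nat \/ n = S (2 * m).
Proof.
  destruct (Nat.Even_or_Odd n) as [[m Hm]|[m Hm]]; exists m; lia.
Qed.

Lemma odd_unit_sum (h : heading) : exists c, unit_x h + unit_y h = 2 * c + 1.
Proof. destruct h; [exists 0|exists 0|exists (-1)|exists (-1)]; reflexivity. Qed.

Lemma levy_balanced (n m : nat) :
  n <> m -> heading_at n = heading_at m ->
  exists k, balanced k (levy_x n - levy_x m) (levy_y n - levy_y m) (Z.of_nat n - Z.of_nat m).
Proof.
  remember (n + m)%nat as s eqn:Hs. revert n m Hs.
  induction s as [s IH] using lt_wf_ind. intros n m Hs Hne Hh.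
  destruct (even_or_odd n) as [n' [Hn|Hn]], (even_or_odd m) as [m' [Hm|Hm]]; subst n m.
  (* The sum of the indices decreases on halving, since distinct indices are not both 0. *)
  - rewrite !heading_at_double in Hh.
    destruct (IH (n' + m')%nat ltac:(lia) n' m' eq_refl ltac:(lia) Hh) as [k Hk]. exists (S k).
    destruct (levy_double n') as [-> ->], (levy_double m') as [-> ->].
    eapply balanced_eq; [exact (balanced_scale _ _ _ _ Hk)|lia..].
  - exists 0%nat. destruct (levy_double n') as [-> ->], (levy_succ_double m') as [-> ->].
    destruct (odd_unit_sum (heading_at m')) as [c Hc].
    apply balanced_odd; apply Z.odd_spec.
    + exists (levy_x n' - levy_x m' - c - 1). lia.
    + exists (Z.of_nat n' - Z.of_nat m' - 1). lia.
  - exists 0%nat. destruct (levy_succ_double n') as [-> ->], (levy_double m') as [-> ->].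
    destruct (odd_unit_sum (heading_at n')) as [c Hc].
    apply balanced_odd; apply Z.odd_spec.
    + exists (levy_x n' - levy_x m' + c). lia.
    + exists (Z.of_nat n' - Z.of_nat m'). lia.
  (* Equal headings make the two extra unit steps cancel, leaving the even case. *)
  - rewrite !heading_at_succ_double in Hh. apply turn_inj in Hh.
    destruct (IH (n' + m')%nat ltac:(lia) n' m' eq_refl ltac:(lia) Hh) as [k Hk]. exists (S k).
    destruct (levy_succ_double n') as [-> ->], (levy_succ_double m') as [-> ->].
    rewrite Hh. eapply balanced_eq; [exact (balanced_scale _ _ _ _ Hk)|lia..].
Qed.

(** * The points of the sequence *)

(* Each heading starts from the corner of the unit square that lies furthest
   along it, so that the steps [2 * unit + (corner' - corner)] stay in
   [{-2, ..., 2}^2]; opposite headings sit at opposite corners. *)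
Definition corner_x (h : heading) : Z :=
  match h with East | North => 1 | West | South => 0 end.

Definition corner_y (h : heading) : Z :=
  match h with North | West => 1 | East | South => 0 end.

Definition heading_index (h : heading) : Z :=
  match h with East => 0 | North => 1 | West => 2 | South => 3 end.

Definition point (n : nat) : Z3 :=
  let h := heading_at n in
  (2 * levy_x n + corner_x h, 2 * levy_y n + corner_y h, 4 * Z.of_nat n + heading_index h).

(** A sum of two odd squares is 2 modulo 4. *)
Lemma balanced_two (a b c d e f : Z) :
  Z.odd d = true -> Z.odd e = true -> Z.odd f = true ->
  balanced 1 (2 * a + d) (2 * b + e) (4 * c + 2 * f).
Proof.
  intros [d' ->]%Z.odd_spec [e' ->]%Z.odd_spec [f' ->]%Z.odd_spec.
  exists ((a + d') * (a + d' + 1) + (b + e') * (b + e' + 1)), (c + f').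
  change (2 ^ Z.of_nat 1) with 2. split; ring.
Qed.

(** Indices of different parity belong to adjacent corners, which differ in exactly one coordinate.
    Otherwise the corners are opposite and the indices differ by 2. *)
Lemma corners_balanced (g h : heading) (a b c : Z) :
  g <> h ->
  exists k, balanced k (2 * a + (corner_x g - corner_x h)) (2 * b + (corner_y g - corner_y h))
              (4 * c + (heading_index g - heading_index h)).
Proof.
  intro Hne.
  destruct (Z.odd (heading_index g - heading_index h)) eqn:Hodd.
  - exists 0%nat. apply balanced_odd.
    + replace (2 * a + (corner_x g - corner_x h) + (2 * b + (corner_y g - corner_y h)))
        with (corner_x g - corner_x h + (corner_y g - corner_y h) + 2 * (a + b)) by ring.
      rewrite Z.odd_add_mul_2. destruct g, h; easy.
    + replace (4 * c + (heading_index g - heading_index h))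
        with (heading_index g - heading_index h + 2 * (2 * c)) by ring.
      now rewrite Z.odd_add_mul_2.
  - exists 1%nat.
    destruct g, h; try easy;
      match goal with |- context [4 * c + ?t] =>
        let t' := eval compute in (t / 2) in change t with (2 * t')
      end; now apply balanced_two.
Qed.

Lemma point_balanced (n m : nat) :
  n <> m ->
  let '(x, y, z) := Z3_sub (point n) (point m) in exists k, balanced k x y z.
Proof.
  intro Hne. cbn [Z3_sub point].
  assert (Hcase : heading_at n = heading_at m \/ heading_at n <> heading_at m) by apply classic.
  destruct Hcase as [Hh|Hh].
  (* Corners and indices cancel; doubling [x] and [y] multiplies the norm by 4, as happens to [z],
     so the exponent grows by 2. *)
  - destruct (levy_balanced n m Hne Hh) as [k Hk]. rewrite Hh. exists (S (S k)).
    destruct Hk as (u & v & Hn & Hz). exists u, v.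
    rewrite !Nat2Z.inj_succ, !Z.pow_succ_r by lia. split; [|lia].
    replace (2 * (2 * 2 ^ Z.of_nat k) * (2 * u + 1))
      with (4 * (2 ^ Z.of_nat k * (2 * u + 1))) by ring.
    rewrite <- Hn. ring.
  - destruct (corners_balanced _ _ (levy_x n - levy_x m) (levy_y n - levy_y m)
      (Z.of_nat n - Z.of_nat m) Hh) as [k Hk].
    exists k.
    eapply balanced_eq; [exact Hk|lia..].
Qed.

(** * Displacements and conclusion *)

Definition step (g h : heading) : Z3 :=
  (2 * unit_x g + (corner_x h - corner_x g), 2 * unit_y g + (corner_y h - corner_y g),
   4 + (heading_index h - heading_index g)).

Lemma displacement_point (n : nat) :
  displacement point n = step (heading_at n) (heading_at (S n)).
Proof.
  unfold displacement, point, step, Z3_sub. cbn [levy_x levy_y].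
  f_equal; [f_equal|]; lia.
Qed.

Theorem theorem1 :
  exists P : nat -> Z3,
    (forall a b c : nat, (a < b)%nat -> (b < c)%nat ->
       ~ collinear (Z3_to_R3 (P a)) (Z3_to_R3 (P b)) (Z3_to_R3 (P c))) /\
    (forall n : nat, step_box (displacement P n)) /\
    at_most 16 (displacements P).
Proof.
  exists point. split; [|split].
  - intros a b c Hab Hbc.
    pose proof (point_balanced b a ltac:(lia)) as H1.
    pose proof (point_balanced c b ltac:(lia)) as H2.
    pose proof (point_balanced c a ltac:(lia)) as H3.
    destruct (point a) as [[x1 y1] z1], (point b) as [[x2 y2] z2], (point c) as [[x3 y3] z3].
    destruct H1 as [i Hi], H2 as [j Hj], H3 as [k Hk].
    exact (balanced_not_collinear _ _ _ _ _ _ _ _ _ i j k Hi Hj Hk).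
  - intro n. rewrite displacement_point.
    (* The bounds hold for every ordered pair of headings. *)
    destruct (heading_at n), (heading_at (S n)); simpl; intuition lia.
  - set (hs := [East; North; West; South]).
    assert (Hhs : forall h, In h hs) by (intros []; simpl; tauto).
    apply (at_most_of_list (map (fun p => step (fst p) (snd p)) (list_prod hs hs))).
    intros d [n _ e ->]. rewrite displacement_point.
    apply (in_map (fun p => step (fst p) (snd p)) _ (heading_at n, heading_at (S n))).
    now apply in_prod.
Qed.
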